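(* Consider the single stage pricing game with linear loyalty described in the context, with parameters $c_A\ge c_B\ge 0$, $l_\alpha,l_\beta>0$, $s_\alpha,s_\beta\ge 0$, $\theta\in(0,1)$, and $F$ the distribution function of the uniform distribution on $[0,1]$. Suppose (Region V) $$s_\alpha-l_\alpha\le c_A-c_B\le \min(s_\alpha+2l_\alpha,\;l_\beta-s_\beta) .$$ Then the game has a unique pure Nash equilibrium, and its prices are $$p_A^\alpha=\tfrac13(2c_A+c_B+s_\alpha+2l_\alpha),\quad p_A^\beta=\tfrac13(c_B+2c_A-s_\beta+l_\beta),$$ $$p_B^\beta=\tfrac13(2c_B+c_A+s_\beta+2l_\beta),\quad p_B^\alpha=\tfrac13(c_A+2c_B-s_\alpha+l_\alpha) .$$
   Context: Two firms $A$ and $B$ sell the same product, with unit product costs $c_A$ and $c_B$, where $c_A\ge c_B\ge 0$. Customers are partitioned into a set $\alpha$ (ex ante loyal to $A$; a fraction $\theta$ of the market; $A$'s strong and $B$'s weak sub-market) and a set $\beta$ (ex ante loyal to $B$; a fraction $1-\theta$; $B$'s strong and $A$'s weak sub-market). Both firms can tell the two sets apart. Each customer buys exactly one unit, from $A$ or from $B$. Firms move simultaneously: $A$ chooses $(p_A^\alpha,p_A^\beta)$ with $p_A^\alpha,p_A^\beta\ge c_A$, and $B$ chooses $(p_B^\beta,p_B^\alpha)$ with $p_B^\beta,p_B^\alpha\ge c_B$; the superscript is the set of customers to which the price is offered. Linear loyalty: a customer in $\alpha$ has loyalty level $l_\alpha\xi+s_\alpha$ and buys from $A$ iff $l_\alpha\xi+s_\alpha\ge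 p_A^\alpha-p_B^\alpha$; a customer in $\beta$ has loyalty level $l_\beta\xi+s_\beta$ and buys from $B$ iff $l_\beta\xi+s_\beta\ge p_B^\beta-p_A^\beta$; here $\xi$ is random with distribution function $F$. Put $\xi^\alpha=(p_A^\alpha-p_B^\alpha-s_\alpha)/l_\alpha$ and $\xi^\beta=(p_B^\beta-p_A^\beta-s_\beta)/l_\beta$. For the uniform distribution, $F(x)=0$ for $x\le 0$, $F(x)=x$ for $0\le x\le1$, $F(x)=1$ for $x\ge1$. Profits: firm $A$ gets $(p_A^\alpha-c_A)\,\theta\,(1-F(\xi^\alpha))+(p_A^\beta-c_A)(1-\theta)F(\xi^\beta)$; firm $B$ gets $(p_B^\beta-c_B)(1-\theta)(1-F(\xi^\beta))+(p_B^\alpha-c_B)\,\theta\,F(\xi^\alpha)$. A pure Nash equilibrium is a price profile $(p_A^\alpha,p_A^\beta,p_B^\beta,p_B^\alpha)$ from which neither firm can strictly increase its profit by unilaterally changing its own (feasible) prices. *)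

(* Defs.v *)
From mathcomp Require Import all_boot all_order all_algebra.
From mathcomp Require Import all_classical all_reals all_analysis.

Set Implicit Arguments.
Unset Strict Implicit.
Unset Printing Implicit Defensive.

Import Order.TTheory GRing.Theory Num.Theory.

Local Open Scope classical_set_scope.
Local Open Scope ring_scope.

Section PricingGame.
Variable R : realType.

(* Customers in alpha (resp. beta) are ex ante loyal to firm A (resp. B), with
   loyalty level [l * xi + s], where [xi] has distribution function [distF];
   [theta] is the market share of alpha. *)
Record game := Game {
  cA : R; cB : R;
  theta : R;
  l_alpha : R; s_alpha : R;
  l_beta : R; s_beta : R;
  distF : R -> R }.

(* The Greek suffix is the set of customers to which the price is offered. *)
Record profile := Profile {
  pA_alpha : R; pA_beta : R;
  pB_beta : R; pB_alpha : R }.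

(* A customer of alpha leaves A for B iff xi < xi_alpha, and a customer of beta
   leaves B for A iff xi < xi_beta. *)
Definition xi_alpha (g : game) (p : profile) : R :=
  (pA_alpha p - pB_alpha p - s_alpha g) / l_alpha g.

Definition xi_beta (g : game) (p : profile) : R :=
  (pB_beta p - pA_beta p - s_beta g) / l_beta g.

Definition profitA (g : game) (p : profile) : R :=
  (pA_alpha p - cA g) * theta g * (1 - distF g (xi_alpha g p)) +
  (pA_beta p - cA g) * (1 - theta g) * distF g (xi_beta g p).

Definition profitB (g : game) (p : profile) : R :=
  (pB_beta p - cB g) * (1 - theta g) * (1 - distF g (xi_beta g p)) +
  (pB_alpha p - cB g) * theta g * distF g (xi_alpha g p).

Definition feasibleA (g : game) (p : profile) : Prop :=
  cA g <= pA_alpha p /\ cA g <= pA_beta p.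

Definition feasibleB (g : game) (p : profile) : Prop :=
  cB g <= pB_beta p /\ cB g <= pB_alpha p.

(* [devA p q] replaces A's prices in [p] by those in [q]. *)
Definition devA (p q : profile) : profile :=
  Profile (pA_alpha q) (pA_beta q) (pB_beta p) (pB_alpha p).

Definition devB (p q : profile) : profile :=
  Profile (pA_alpha p) (pA_beta p) (pB_beta q) (pB_alpha q).

Definition nash_equilibrium (g : game) (p : profile) : Prop :=
  [/\ feasibleA g p, feasibleB g p,
      forall q, feasibleA g q -> profitA g (devA p q) <= profitA g p
    & forall q, feasibleB g q -> profitB g (devB p q) <= profitB g p].

Definition uniform01_cdf (x : R) : R :=
  if x <= 0 then 0 else if x <= 1 then x else 1.

Lemma uniform01_cdfE (x : R) :
  uniform_prob (@ltr01 R) `]-oo, x] = (uniform01_cdf x)%:E.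
Proof.
rewrite /uniform_prob integral_uniform_pdf.
have -> : `]-oo, x] `&` `[0, 1] = [set` `[0, Num.min x 1]] :> set R.
  apply/seteqP; split => y /=; rewrite !in_itv /= le_min.
    by case=> -> /andP[-> ->].
  by case/and3P => -> -> ->.
rewrite (eq_integral (cst 1%:E)); last first.
  move=> y; rewrite inE /= in_itv /= le_min => /and3P[y0 _ y1].
  by rewrite /uniform_pdf y0 y1 /= subr0 invr1.
rewrite integral_cst //= mul1e lebesgue_measure_itv /= lte_fin /uniform01_cdf.
rewrite lt_min ltr01 andbT ltNge; case: (leP x 0) => //= x0.
by rewrite sube0; case: leP.
Qed.

End PricingGame.

(* Main.v *)
(* The game splits into two independent duels, one on each set of customers.
   Since [1 - F t = F (1 - t)] for the uniform distribution, every firm in either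
   duel maximizes [x * F ((a - x) / l)] over its mark-up [x >= 0], where [a]
   depends only on the price of its rival.  The maximizer is unique when [a > 0],
   and any [x] is optimal when [a <= 0].  With [d] the cost disadvantage minus the
   loyalty intercept, a duel with mark-ups [x], [y] has [a = y + l - d] for the
   strong firm and [a = x + d] for the weak one, and the two best-response
   conditions have a single common solution when [- l <= d <= 2 * l]. *)

Require Import Defs.
From mathcomp Require Import all_boot all_order all_algebra.
From mathcomp Require Import all_classical all_reals all_analysis.
From mathcomp Require Import ring lra.

Set Implicit Arguments.
Unset Strict Implicit.
Unset Printing Implicit Defensive.

Import Order.TTheory GRing.Theory Num.Theory.
Local Open Scope ring_scope.

Section Duel.
Variable R : realType.
Implicit Types (l a d x y z t : R).

Definition payoff l a x : R := x * uniform01_cdf ((a - x) / l).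

Definition best_response l a x : Prop :=
  0 <= x /\ forall z, 0 <= z -> payoff l a z <= payoff l a x.

Lemma uniform01_cdf_onem t : 1 - uniform01_cdf t = uniform01_cdf (1 - t).
Proof.
rewrite /uniform01_cdf.
by case: (leP t 0); case: (leP t 1); case: (leP (1 - t) 0);
  case: (leP (1 - t) 1) => *; lra.
Qed.

(** Clamping [a - x] to [[0, l]] moves the division by [l] outside, where it cancels when two
    payoffs are compared. *)
Lemma payoff_clamp l a x : 0 < l ->
  payoff l a x = x * Num.max 0 (Num.min (a - x) l) / l.
Proof.
move=> l0; rewrite /payoff /uniform01_cdf -mulrA; congr (_ * _).
rewrite ler_pdivrMr // mul0r ler_pdivrMr // mul1r.
have [ax|ax] := leP (a - x) 0.
  by rewrite max_l ?mul0r // ge_min ax.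
rewrite max_r; last by rewrite le_min !ltW.
by case: leP => // _; rewrite divff // gt_eqF.
Qed.

(** Up to the factor [1 / l], the payoff is [z * l] up to the kink [a - l], the parabola
    [z * (a - z)] from there to [a], and [0] beyond. Its peak is the vertex [a / 2], or the kink if
    that lies further right. *)
Lemma payoff_lt_max l a z : 0 < l -> 0 < a -> 0 <= z ->
  z != Num.max (a / 2) (a - l) ->
  payoff l a z < payoff l a (Num.max (a / 2) (a - l)).
Proof.
move=> l0 a0 z0; set m := Num.max _ _ => zm.
rewrite !payoff_clamp // ltr_pM2r ?invr_gt0 //.
have [m1 m2] : a / 2 <= m /\ a - l <= m by rewrite !le_max !lexx orbT.
have m3 : m < a by rewrite gt_max; apply/andP; split; lra.
have -> : Num.max 0 (Num.min (a - m) l) = a - m.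
  by rewrite min_l ?max_r //; lra.
have [az|za] := leP a z.
  rewrite max_l ?mulr0; first by apply: mulr_gt0; lra.
  by rewrite ge_min; apply/orP; left; lra.
rewrite max_r; last by rewrite le_min; apply/andP; split; lra.
have mE : m = a / 2 \/ m = a - l.
  by rewrite /m; case: leP; [right|left].
have [zltm|mltz|/eqP] := ltgtP z m; last by rewrite (negPf zm).
(* Left of [m], the clamp is bounded by [a - z] if [m] is the vertex and by [l] if [m] is the kink.
   Right of [m], the parabola strictly decreases because [a / 2 <= m]. *)
- case: mE => mE.
    apply: (@le_lt_trans _ _ (z * (a - z))).
      by rewrite ler_wpM2l // ge_min lexx.
    by rewrite mE in zltm *; nra.
  apply: (@le_lt_trans _ _ (z * l)).
    by rewrite ler_wpM2l // ge_min lexx orbT.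
  by rewrite mE in zltm *; nra.
apply: (@le_lt_trans _ _ (z * (a - z))).
  by rewrite ler_wpM2l // ge_min lexx.
by nra.
Qed.

Lemma best_responseP l a x : 0 < l ->
  best_response l a x <->
  0 <= x /\ (0 < a -> x = Num.max (a / 2) (a - l)).
Proof.
move=> l0; split=> -[x0 xmax]; split=> //.
  move=> a0; apply/eqP/negPn/negP => xm.
  have := payoff_lt_max l0 a0 x0 xm; rewrite ltNge xmax //.
  by rewrite le_max; apply/orP; left; lra.
move=> z z0; have [a0|a0] := leP a 0.
  have payoff0 y : 0 <= y -> payoff l a y = 0.
    move=> y0; rewrite payoff_clamp // max_l ?mulr0 ?mul0r //.
    by rewrite ge_min; apply/orP; left; lra.
  by rewrite !payoff0.
rewrite (xmax a0); have [->//|zm] := eqVneq z (Num.max (a / 2) (a - l)).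
exact/ltW/payoff_lt_max.
Qed.

Lemma duel_equilibriumP l d x y : 0 < l -> - l <= d -> d <= 2 * l ->
  best_response l (y + l - d) x /\ best_response l (x + d) y <->
  x = (2 * l - d) / 3 /\ y = (l + d) / 3.
Proof.
move=> l0 d1 d2; rewrite !best_responseP //; split; last first.
  by move=> [-> ->]; split; (split=> [|_]; [lra|rewrite max_l; lra]).
move=> [[x0 xE] [y0 yE]].
(* The two quantities add up to [x + y + l > 0], so they are not both nonpositive. The first is so
   only if [d = 2 * l] and [x = 0], the second only if [d = - l] and [y = 0]; both fit the formulas.
   If both are positive, the kink branches are contradictory and two linear equations remain. *)
have [a0|a0] := leP (y + l - d) 0; have [b0|b0] := leP (x + d) 0.
- lra.
- by move: (yE b0); case: leP => *; split; lra.
- by move: (xE a0); case: leP => *; split; lra.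
- move: (xE a0); case: leP => ? ?; move: (yE b0); case: leP => *.
  all: by split; lra.
Qed.

(** Reduces a firm's joint deviations to one market at a time: fix one coordinate at its optimum and
    cancel the positive weight of the other. *)
Lemma separable_maxP (P Q : R -> Prop) (u v : R -> R) t x y :
  0 < t -> t < 1 -> P x -> Q y ->
  (forall x' y', P x' -> Q y' ->
     t * u x' + (1 - t) * v y' <= t * u x + (1 - t) * v y) <->
  (forall x', P x' -> u x' <= u x) /\ (forall y', Q y' -> v y' <= v y).
Proof.
move=> t0 t1 Px Qy; have t1' : 0 < 1 - t by rewrite subr_gt0.
split=> [uv|[ux vy] x' y' Px' Qy'].
  split=> [x' Px'|y' Qy'].
    by move: (uv _ _ Px' Qy); rewrite lerD2r ler_pM2l.
  by move: (uv _ _ Px Qy'); rewrite lerD2l ler_pM2l.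
by rewrite lerD // ler_pM2l //; [exact: ux|exact: vy].
Qed.

End Duel.

Section UniformGame.
Variables (R : realType) (cA cB theta la sa lb sb : R).
Hypotheses (la0 : 0 < la) (lb0 : 0 < lb).

Let g := Game cA cB theta la sa lb sb (@uniform01_cdf R).

Lemma profitA_payoff p :
  profitA g p =
  theta * payoff la (pB_alpha p - cB + la - (cA - cB - sa)) (pA_alpha p - cA) +
  (1 - theta) * payoff lb (pB_beta p - cB + (cB - cA - sb)) (pA_beta p - cA).
Proof.
rewrite /profitA uniform01_cdf_onem /payoff /xi_alpha /xi_beta /=.
rewrite [_ * theta]mulrC [_ * (1 - theta)]mulrC -!mulrA.
congr (_ * (_ * uniform01_cdf _) + _ * (_ * uniform01_cdf _)).
  by field; rewrite gt_eqF.
by congr (_ / _); ring.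
Qed.

Lemma profitB_payoff p :
  profitB g p =
  theta * payoff la (pA_alpha p - cA + (cA - cB - sa)) (pB_alpha p - cB) +
  (1 - theta) *
    payoff lb (pA_beta p - cA + lb - (cB - cA - sb)) (pB_beta p - cB).
Proof.
rewrite addrC /profitB uniform01_cdf_onem /payoff /xi_alpha /xi_beta /=.
rewrite [_ * theta]mulrC [_ * (1 - theta)]mulrC -!mulrA.
congr (_ * (_ * uniform01_cdf _) + _ * (_ * uniform01_cdf _)).
  by field; rewrite gt_eqF.
by congr (_ / _); ring.
Qed.

Hypotheses (theta0 : 0 < theta) (theta1 : theta < 1).

Lemma nash_equilibrium_duelsP p :
  nash_equilibrium g p <->
  (best_response la (pB_alpha p - cB + la - (cA - cB - sa)) (pA_alpha p - cA) /\
   best_response la (pA_alpha p - cA + (cA - cB - sa)) (pB_alpha p - cB)) /\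
  (best_response lb (pA_beta p - cA + lb - (cB - cA - sb)) (pB_beta p - cB) /\
   best_response lb (pB_beta p - cB + (cB - cA - sb)) (pA_beta p - cA)).
Proof.
case: p => aa ab bb ba /=; set d := cA - cB - sa; set e := cB - cA - sb.
pose nneg z : Prop := 0 <= z :> R.
split=> [[[/= A1 A2] [/= B1 B2] NA NB]|].
  have [/= aa0 ab0 bb0 ba0] :
    [/\ nneg (aa - cA), nneg (ab - cA), nneg (bb - cB) & nneg (ba - cB)].
    by split; rewrite /nneg subr_ge0.
  have [|aaP abP] := (separable_maxP (payoff la (ba - cB + la - d))
    (payoff lb (bb - cB + e)) theta0 theta1 aa0 ab0).1.
    move=> x y x0 y0.
    (* Mark-ups become prices again; the zeros stand for B's prices, which [devA] ignores. *)
    have := NA (Profile (x + cA) (y + cA) 0 0).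
    by rewrite !profitA_payoff /= !addrK; apply; split; rewrite /= lerDr.
  have [|baP bbP] := (separable_maxP (payoff la (aa - cA + d))
    (payoff lb (ab - cA + lb - e)) theta0 theta1 ba0 bb0).1.
    move=> x y x0 y0.
    have := NB (Profile 0 0 (y + cB) (x + cB)).
    by rewrite !profitB_payoff /= !addrK; apply; split; rewrite /= lerDr.
  by split; split; split.
move=> [[[aa0 aaP] [ba0 baP]] [[bb0 bbP] [ab0 abP]]]; split.
- by split; rewrite /= -subr_ge0.
- by split; rewrite /= -subr_ge0.
- move=> q [/= q1 q2]; rewrite !profitA_payoff /=.
  apply: (separable_maxP (P := nneg) (Q := nneg) (payoff la (ba - cB + la - d))
    (payoff lb (bb - cB + e)) theta0 theta1 _ _).2 => //;
    by rewrite /nneg subr_ge0.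
- move=> q [/= q1 q2]; rewrite !profitB_payoff /=.
  apply: (separable_maxP (P := nneg) (Q := nneg) (payoff la (aa - cA + d))
    (payoff lb (ab - cA + lb - e)) theta0 theta1 _ _).2 => //;
    by rewrite /nneg subr_ge0.
Qed.

End UniformGame.

Theorem proposition7 (R : realType) (cA cB theta lalpha salpha lbeta sbeta : R)
    (hcB : 0 <= cB) (hcA : cB <= cA)
    (hlalpha : 0 < lalpha) (hlbeta : 0 < lbeta)
    (hsalpha : 0 <= salpha) (hsbeta : 0 <= sbeta)
    (htheta0 : 0 < theta) (htheta1 : theta < 1)
    (hV1 : salpha - lalpha <= cA - cB)
    (hV2 : cA - cB <= Num.min (salpha + 2 * lalpha) (lbeta - sbeta)) :
  unique
    (nash_equilibrium
       (Game cA cB theta lalpha salpha lbeta sbeta (@uniform01_cdf R)))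
    {| pA_alpha := 3^-1 * (2 * cA + cB + salpha + 2 * lalpha);
       pA_beta := 3^-1 * (cB + 2 * cA - sbeta + lbeta);
       pB_beta := 3^-1 * (2 * cB + cA + sbeta + 2 * lbeta);
       pB_alpha := 3^-1 * (cA + 2 * cB - salpha + lalpha) |}.
Proof.
move: hV2; rewrite le_min => /andP[hV2a hV2b].
have nashP p := nash_equilibrium_duelsP cA cB salpha sbeta
  hlalpha hlbeta htheta0 htheta1 p.
(* The [_] is filled in by [duel_equilibriumP]. Region V supplies both of its bounds here; for
   [betaP] the upper bound follows from [cB <= cA] and [0 <= sbeta]. *)
have alphaP x y : best_response lalpha (y + lalpha - (cA - cB - salpha)) x /\
    best_response lalpha (x + (cA - cB - salpha)) y <-> _ :=
  ltac:(apply: duel_equilibriumP; lra).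
have betaP x y : best_response lbeta (y + lbeta - (cB - cA - sbeta)) x /\
    best_response lbeta (x + (cB - cA - sbeta)) y <-> _ :=
  ltac:(apply: duel_equilibriumP; lra).
split.
  apply/nashP/and_comm; split=> /=; [apply/betaP|apply/alphaP]; split; lra.
move=> [aa ab bb ba] /nashP/= [/alphaP[? ?] /betaP[? ?]].
by congr Profile; lra.
Qed.
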